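(* Let $c>0$, let $N$ be a positive integer, and let $\psi$ be an alternating step function of height $c$ and order $N$. Then there is a finite Blaschke product $\omega$ of order $N$ such that $\psi=\frac{2c}{\pi}\operatorname{Arg}\left(\frac{1+\omega}{1-\omega}\right)$ (a.e.) on $\mathbb{T}$.
   Context: $\mathbb{T}$ is the unit circle; $\operatorname{Arg}$ denotes the principal value of the argument. For $c>0$ and $N$ a positive integer, an alternating step function of height $c$ and order $N$ is a function in $L^\infty(\mathbb{T})$ that assumes (a.e.) alternately the values $c$ and $-c$ on $2N$ (nondegenerate) subarcs forming a partition of $\mathbb{T}$. *)

(* Defs.v *)
From HB Require Import structures.
From mathcomp Require Import all_boot all_order all_algebra.
From mathcomp Require Import all_classical all_reals all_analysis.
From mathcomp Require Import complex.
Set Implicit Arguments. Unset Strict Implicit. Unset Printing Implicit Defensive.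
Import Order.TTheory GRing.Theory Num.Theory.
Local Open Scope ring_scope.
Local Open Scope complex_scope.
Local Open Scope classical_set_scope.

Definition expi {R : realType} (t : R) : R[i] := cos t +i* sin t.

(* Principal value of the argument, with values in (-pi, pi]
   (standard atan2 formula); Arg 0 := 0 by convention. *)
Definition Arg {R : realType} (z : R[i]) : R :=
  let x : R := complex.Re z in let y : R := complex.Im z in
  if 0 < x then atan (y / x)
  else if x < 0 then (if 0 <= y then atan (y / x) + pi else atan (y / x) - pi)
  else if 0 < y then pi / 2
  else if y < 0 then - (pi / 2)
  else 0.

Definition blaschke {R : realType} (N : nat) (lam : R[i]) (a : 'I_N -> R[i])
  (z : R[i]) : R[i] :=
  lam * \prod_(k < N) ((z - a k) / (1 - (a k)^* * z)).

Definition finite_blaschke_of_order {R : realType} (N : nat)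
  (omega : R[i] -> R[i]) : Prop :=
  exists (lam : R[i]) (a : 'I_N -> R[i]),
    `|lam| = 1 /\ (forall k, `|a k| < 1) /\ omega = blaschke lam a.

(* psi : T -> R (given as a function on R[i], only its values on T matter)
   is an alternating step function of height c and order N: there are
   angles t_0 < t_1 < ... < t_{2N} = t_0 + 2 pi (2N nondegenerate arcs
   partitioning T) such that a.e. on the j-th arc psi = (-1)^j c.
   Almost-everywhere is w.r.t. Lebesgue measure in the angle variable
   (i.e. arc-length measure on T). *)
Definition alternating_step {R : realType} (c : R) (N : nat)
  (psi : R[i] -> R) : Prop :=
  exists t : nat -> R,
    (forall j, (j < 2 * N)%N -> t j < t j.+1) /\
    t (2 * N)%N = t 0%N + 2 * pi /\
    (forall j, (j < 2 * N)%N ->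
       {ae (@lebesgue_measure R), forall th : R,
          th \in `]t j, t j.+1[ -> psi (expi th) = (-1) ^+ j * c}).

(* Main.v *)
(* Let e_k and f_k be the even and odd division points of the circle, and let
   T(z) = kappa * prod_k (z - f_k) / (z - e_k). Writing
   exp(ix) - exp(iy) = 2i sin((x - y)/2) exp(i(x + y)/2), a suitable unimodular
   kappa makes T(exp(i th)) = i y(th), where y is real, a quotient of products of
   sines, and has sign (-1)^j on the j-th arc. Hence (2c/pi) Arg T is the step
   function, and omega = (T - 1)/(T + 1) is the function sought once the zeros of
   T - 1 are known to lie in the disc. Partial fractions give
   T + T^* = 2 (1 - |z|^2) sum_k m_k / |z - e_k|^2, and the interlacing of the two
   families of points makes all m_k positive; so T = 1 forces |z| < 1. *)
Require Import Defs.
From HB Require Import structures.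
From mathcomp Require Import all_boot all_order all_algebra.
From mathcomp Require Import all_classical all_reals all_analysis.
From mathcomp Require Import complex ring lra zify.
Import Order.TTheory GRing.Theory Num.Theory.
Local Open Scope ring_scope.

(** * Partial fractions at distinct simple poles *)

Lemma horner_prod_XsubC (F : comNzRingType) (I : finType) (P : pred I)
    (e : I -> F) (x : F) :
  (\prod_(i | P i) ('X - (e i)%:P)).[x] = \prod_(i | P i) (x - e i).
Proof. by rewrite horner_prod; apply: eq_bigr => i _; rewrite !hornerE. Qed.

Lemma size_prod_ord_XsubC (F : nzRingType) (N : nat) (e : 'I_N -> F) :
  size (\prod_(k < N) ('X - (e k)%:P)) = N.+1.
Proof. by rewrite size_prod_XsubC -[index_enum _]enumT size_enum_ord. Qed.

(** Lagrange interpolation: the difference between [D] and its interpolant [L] at the nodes has [N]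
    distinct roots but size at most [N], so it is zero; dividing [L] by the full product leaves
    simple fractions. *)
Lemma partial_fractions (F : fieldType) (N : nat) (e : 'I_N -> F)
    (D : {poly F}) (z : F) :
  injective e -> (size D <= N)%N -> (forall k, z != e k) ->
  D.[z] / \prod_(k < N) (z - e k) =
  \sum_(k < N) D.[e k] / (\prod_(l < N | l != k) (e k - e l)) / (z - e k).
Proof.
move=> inj_e szD zNe.
pose q (k : 'I_N) : {poly F} := \prod_(l < N | l != k) ('X - (e l)%:P).
have qE k x : (q k).[x] = \prod_(l < N | l != k) (x - e l).
  exact: horner_prod_XsubC.
have qk0 k : (q k).[e k] != 0.
  by rewrite qE; apply/prodf_neq0 => l lk; rewrite subr_eq0 (inj_eq inj_e) eq_sym.
pose L : {poly F} := \sum_(k < N) (D.[e k] / (q k).[e k]) *: q k.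
have DL : D = L.
  apply/eqP; rewrite -subr_eq0; apply: contraT => DL0.
  have := @max_poly_roots _ (D - L) (codom e) DL0.
  rewrite (map_inj_uniq inj_e) enum_uniq size_codom card_ord.
  have szL : (size (D - L)%R <= N)%N.
    apply: (leq_trans (size_polyD _ _)); rewrite size_polyN geq_max szD /=.
    apply: (leq_trans (size_sum _ _ _)); apply/bigmax_leqP => k _.
    apply: (leq_trans (size_scale_leq _ _)).
    rewrite /q size_prod; last by move=> l _; rewrite polyXsubC_eq0.
    under eq_bigr do rewrite size_XsubC.
    rewrite sum_nat_const (_ : #|_| = N.-1)%N; last by rewrite cardC1 card_ord.
    by have := ltn_ord k; lia.
  move=> /(_ _ isT); rewrite ltnNge szL; apply.
  apply/allP => _ /codomP [k ->]; rewrite rootE !hornerE horner_sum.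
  rewrite (bigD1 k) //= hornerE divfK // big1 ?addr0 ?subrr // => l lk.
  rewrite hornerE [X in _ * X]qE (bigD1 k) //= 1?eq_sym // subrr mul0r mulr0 //.
rewrite {1}DL horner_sum mulr_suml; apply: eq_bigr => k _.
rewrite hornerE (bigD1 k) //= !qE.
have zk : z - e k != 0 by rewrite subr_eq0.
have pz : \prod_(l < N | l != k) (z - e l) != 0.
  by apply/prodf_neq0 => l _; rewrite subr_eq0.
have := qk0 k; rewrite qE => qq.
by field; rewrite zk pz qq.
Qed.

(** * The quotient [T]: its real part and its Blaschke form *)

Section NumClosed.
Variable (C : numClosedFieldType).
Implicit Types (z e : C).

(** As [- 2 * e / (z - e)] is 1 plus the Herglotz kernel [(e + z) / (e - z)], its real part is 1
    plus the Poisson kernel. *)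
Lemma cayley_re e z : e * e^* = 1 -> z != e ->
  - 2 * e / (z - e) + (- 2 * e / (z - e))^* =
  2 * (1 + (1 - z * z^*) / `|z - e| ^+ 2).
Proof.
move=> e1 ze.
have e0 : e != 0 by apply: contra_eq_neq e1 => ->; rewrite mul0r eq_sym oner_eq0.
have ec : e^* = e^-1 by apply: (mulfI e0); rewrite e1 mulfV.
rewrite normCK.
have d0 : z - e != 0 by rewrite subr_eq0.
have d1 : (z - e)^* != 0 by rewrite conjC_eq0.
have -> : (- 2 * e / (z - e))^* = - 2 * e^* / (z - e)^*.
  by rewrite !rmorphM fmorphV rmorphN rmorph_nat.
move: d1; rewrite rmorphB /= ec => d1.
have d2 : z^* * e - 1 != 0.
  by apply: contra_neq d1 => h; apply: (mulIf e0); rewrite mulrBl mulVf // h mul0r.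
by field; rewrite e0 d0 d2.
Qed.

Lemma cayleyK z : z + 1 != 0 ->
  (1 + (z - 1) / (z + 1)) / (1 - (z - 1) / (z + 1)) = z.
Proof.
move=> z1; have two0 : (2 : C) != 0 by rewrite pnatr_eq0.
have -> : 1 - (z - 1) / (z + 1) = 2 / (z + 1) by field.
by field.
Qed.

(* The hypothesis [residue] says that the residue of T at [e k] is
   [- 2 * m k * e k], so that T is an imaginary constant plus the sum of the
   Herglotz kernels m_k (e_k + z) / (e_k - z). *)
Section Positive.
Context (N : nat) (e f m : 'I_N -> C) (kappa : C).
Hypotheses (inj_e : injective e) (e_unit : forall k, e k * (e k)^* = 1).
Hypothesis m_ge0 : forall k, 0 <= m k.
Hypothesis residue : forall k,
  kappa * \prod_(l < N) (e k - f l) / \prod_(l < N | l != k) (e k - e l) =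
  - 2 * m k * e k.

Let T z := kappa * \prod_(k < N) ((z - f k) / (z - e k)).

Lemma quotient_expansion z : (forall k, z != e k) ->
  T z = kappa + \sum_(k < N) m k * (- 2 * e k / (z - e k)).
Proof.
move=> zNe.
pose A : {poly C} := \prod_(k < N) ('X - (e k)%:P).
pose B : {poly C} := \prod_(k < N) ('X - (f k)%:P).
have hA x : A.[x] = \prod_(k < N) (x - e k) by exact: horner_prod_XsubC.
have hB x : B.[x] = \prod_(k < N) (x - f k) by exact: horner_prod_XsubC.
have mA : A \is monic by exact: monic_prod_XsubC.
have mB : B \is monic by exact: monic_prod_XsubC.
have szA : size A = N.+1 by exact: size_prod_ord_XsubC.
have szB : size B = N.+1 by exact: size_prod_ord_XsubC.
have A0 : A.[z] != 0 by rewrite hA; apply/prodf_neq0 => k _; rewrite subr_eq0.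
(* [A] and [B] are monic of the same degree, so the top coefficient cancels and partial fractions
   apply to [T - kappa]. *)
have szD : (size (B - A)%R <= N)%N.
  apply/leq_sizeP => j; rewrite leq_eqVlt coefB => /predU1P[<-|Nj].
    by move: mA mB; rewrite !monicE /lead_coef szA szB /= => /eqP-> /eqP->; rewrite subrr.
  by rewrite !nth_default ?subrr ?szA ?szB.
have := partial_fractions _ _ _ (kappa *: (B - A)) z inj_e.
move=> /(_ (leq_trans (size_scale_leq _ _) szD) zNe).
rewrite -hA hornerZ hornerD hornerN => pf.
rewrite /T prodf_div -hA -hB.
have -> : kappa * (B.[z] / A.[z]) = kappa + kappa * (B.[z] - A.[z]) / A.[z].
  by field.
rewrite pf; congr (_ + _); apply: eq_bigr => k _.
rewrite !hornerE hB hA [X in _ - X](bigD1 k) //= subrr mul0r subr0 residue.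
by ring.
Qed.

Lemma quotient_re z : (forall k, z != e k) ->
  T z + (T z)^* = kappa + kappa^* + 2 * (\sum_(k < N) m k) +
    2 * (1 - z * z^*) * \sum_(k < N) m k / `|z - e k| ^+ 2.
Proof.
move=> zNe; rewrite quotient_expansion // rmorphD rmorph_sum /=.
rewrite addrACA -[RHS]addrA; congr (_ + _).
rewrite -big_split !mulr_sumr -big_split /=; apply: eq_bigr => k _.
rewrite rmorphM /= (CrealP (ger0_real (m_ge0 k))) -mulrDr cayley_re //.
by ring.
Qed.

Context (k0 : 'I_N).
Hypotheses (f_unit : f k0 * (f k0)^* = 1) (fe_neq : forall k l, f l != e k).

(** At the zero [f k0] of [T], which lies on the circle, [1 - z * z^*] vanishes too, so only the
    constant term of [quotient_re] survives and it must be 0. *)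
Lemma quotient_re0 : kappa + kappa^* = - (2 * (\sum_(k < N) m k)).
Proof.
have := quotient_re _ (fe_neq^~ k0).
have -> : T (f k0) = 0 by rewrite /T (bigD1 k0) //= subrr !mul0r mulr0.
rewrite f_unit subrr mulr0 mul0r addr0 rmorph0 addr0 => /eqP.
by rewrite eq_sym addr_eq0 => /eqP.
Qed.

Lemma quotient_re_disc z : (forall k, z != e k) ->
  T z + (T z)^* = 2 * (1 - z * z^*) * \sum_(k < N) m k / `|z - e k| ^+ 2.
Proof. by move=> zNe; rewrite quotient_re // quotient_re0 addNr add0r. Qed.

Lemma quotient_eq1_disc z : (forall k, z != e k) -> T z = 1 -> `|z| < 1.
Proof.
move=> zNe T1; have := quotient_re_disc z zNe.
rewrite T1 rmorph1 => h.
set S := \sum_(k < N) _ in h.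
have S0 : 0 <= S.
  by apply: sumr_ge0 => k _; apply: mulr_ge0 => //; rewrite invr_ge0 exprn_ge0.
rewrite -(@expr_lt1 _ 2) // normCK -subr_gt0.
have h1 : (1 - z * z^*) * S = 1.
  have two0 : (2 : C) != 0 by rewrite pnatr_eq0.
  by apply: (mulfI two0); rewrite mulrA -h; ring.
have S1 : 0 < S.
  rewrite lt0r S0 andbT; apply: contra_eq_neq h1 => ->.
  by rewrite mulr0 eq_sym oner_eq0.
by rewrite -(pmulr_lgt0 _ S1) h1 ltr01.
Qed.

(* The omega below is (T - 1) / (T + 1): its zeros are the solutions of T = 1,
   and on the circle 1 - a^* z = z (z - a)^*, so its denominator is obtained
   from its numerator by conjugation. *)
Lemma blaschke_of_quotient : kappa != 0 ->
  exists (lam : C) (a : 'I_N -> C), `|lam| = 1 /\ (forall k, `|a k| < 1) /\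
    forall z, z * z^* = 1 -> (forall k, z != e k) ->
      lam * \prod_(k < N) ((z - a k) / (1 - (a k)^* * z)) = (T z - 1) / (T z + 1).
Proof.
move=> kappa0.
pose A : {poly C} := \prod_(k < N) ('X - (e k)%:P).
pose B : {poly C} := \prod_(k < N) ('X - (f k)%:P).
have hA x : A.[x] = \prod_(k < N) (x - e k) by exact: horner_prod_XsubC.
have hB x : B.[x] = \prod_(k < N) (x - f k) by exact: horner_prod_XsubC.
have mA : A \is monic by exact: monic_prod_XsubC.
have mB : B \is monic by exact: monic_prod_XsubC.
have szA : size A = N.+1 by exact: size_prod_ord_XsubC.
have szB : size B = N.+1 by exact: size_prod_ord_XsubC.
(* [kappa = 1] would make [kappa + kappa^*] equal to 2, while [quotient_re0] makes it nonpositive.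
   Hence [P] below has degree exactly [N]. *)
have kappa1 : kappa - 1 != 0.
  rewrite subr_eq0; apply: contra_eq_neq quotient_re0 => ->.
  rewrite rmorph1 -subr_eq0 opprK gt_eqF //.
  by apply: ltr_pwDl; rewrite ?addr_gt0 // mulr_ge0 // sumr_ge0.
pose P := kappa *: B - A.
have PN : P`_N = kappa - 1.
  move: mA mB; rewrite !monicE /lead_coef szA szB /= => /eqP a1 /eqP b1.
  by rewrite coefB coefZ a1 b1 mulr1.
have szP : size P = N.+1.
  apply/eqP; rewrite eqn_leq; apply/andP; split; last first.
    by rewrite ltnNge; apply/negP => /leq_sizeP/(_ _ (leqnn N)) /eqP; rewrite PN (negPf kappa1).
  apply: (leq_trans (size_polyD _ _)); rewrite size_polyN geq_max szA leqnn andbT.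
  by rewrite (leq_trans (size_scale_leq _ _)) // szB.
have lcP : lead_coef P = kappa - 1 by rewrite /lead_coef szP.
have [r rP] := closed_field_poly_normal P.
have szr : size r = N.
  by apply: succn_inj; rewrite -szP rP size_scale ?lcP // size_prod_XsubC.
rewrite lcP in rP.
pose a (k : 'I_N) := r`_k.
have hP x : P.[x] = (kappa - 1) * \prod_(k < N) (x - a k).
  rewrite rP hornerZ horner_prod (big_nth 0) szr big_mkord.
  by congr (_ * _); apply: eq_bigr => k _; rewrite !hornerE.
have hPAB x : P.[x] = kappa * B.[x] - A.[x] by rewrite /P !hornerE.
have PT z : (forall k, z != e k) -> P.[z] = A.[z] * (T z - 1).
  move=> zNe; have A0 : A.[z] != 0 by rewrite hA; apply/prodf_neq0 => k _; rewrite subr_eq0.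
  by rewrite hPAB /T prodf_div -hA -hB; field.
have a_disc k : `|a k| < 1.
  have Pa : P.[a k] = 0 by rewrite hP (bigD1 k) //= subrr mul0r mulr0.
  (* A root of [P] is no pole: at [e l] the polynomial [A] vanishes and [kappa * B] does not. *)
  have aNe l : a k != e l.
    apply: contra_eq_neq Pa => ->; rewrite hPAB hA [X in _ - X](bigD1 l) //= subrr mul0r subr0.
    by rewrite mulf_neq0 // hB; apply/prodf_neq0 => j _; rewrite subr_eq0 eq_sym.
  apply: quotient_eq1_disc => //; move: Pa; rewrite PT // => /eqP.
  rewrite mulf_eq0 hA => /orP[/prodf_eq0 [l _]|]; rewrite subr_eq0 ?(negPf (aNe l)) // => /eqP //.
pose c := kappa - 1.
have c0 : c^* != 0 by rewrite conjC_eq0.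
pose E := \prod_(k < N) (- e k).
have E1 : `|E| = 1.
  rewrite normr_prod big1 // => k _; rewrite normrN.
  by apply/eqP; rewrite -sqrp_eq1 // normCK e_unit.
have E0 : E != 0 by rewrite -normr_eq0 E1 oner_eq0.
(* With [A = E * z ^+ N * A^*] and [T^* = - T] on the circle, the product comes out as
   [(T - 1) / (T + 1)] times [- E * c^* / c]; this [lam] is the inverse of that constant. *)
exists (- (c / c^*) / E), a; split.
  by rewrite normf_div normrN normf_div norm_conjC E1 divr1 divff // normr_eq0.
split => // z z1 zNe.
have Tre : (T z)^* = - T z.
  apply/eqP; rewrite -addr_eq0 addrC quotient_re_disc // z1 subrr mulr0 mul0r //.
have A0 : A.[z] != 0 by rewrite hA; apply/prodf_neq0 => k _; rewrite subr_eq0.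
(* On the circle each factor satisfies [z - e k = - e k * z * (z - e k)^*]. *)
have Ac : A.[z] = E * z ^+ N * A.[z]^*.
  rewrite hA rmorph_prod /= -[N in z ^+ N]card_ord -prodr_const -!big_split /=.
  apply: eq_bigr => k _; rewrite rmorphB /=.
  have -> : - e k * z * (z^* - (e k)^*) = - e k * (z * z^*) + (e k * (e k)^*) * z by ring.
  by rewrite z1 e_unit; ring.
have Tp : T z + 1 != 0.
  apply: contra_eq_neq Tre => /eqP; rewrite addr_eq0 => /eqP ->.
  by rewrite rmorphN rmorph1 opprK eq_sym -subr_eq0 opprK; apply: lt0r_neq0; rewrite addr_gt0.
have Q0 : A.[z]^* != 0 by rewrite conjC_eq0.
have -> : \prod_(k < N) ((z - a k) / (1 - (a k)^* * z)) =
    (P.[z] / c) / (z ^+ N * (P.[z] / c)^*).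
  have -> : P.[z] / c = \prod_(k < N) (z - a k) by rewrite hP mulrAC divff ?mul1r.
  rewrite prodf_div rmorph_prod /= -[N in z ^+ N]card_ord -prodr_const -big_split /=.
  by congr (_ / _); apply: eq_bigr => k _; rewrite rmorphB /= mulrBr z1; ring.
rewrite PT //; move: (T z) Tre Tp => t tc t1.
have -> : (A.[z] * (t - 1) / c)^* = A.[z]^* * (- t - 1) / c^*.
  by rewrite rmorphM fmorphV rmorphM rmorphB rmorph1 /= tc.
rewrite {1}Ac.
have z0 : z != 0 by apply: contra_eq_neq z1 => ->; rewrite mul0r eq_sym oner_eq0.
have zn0 : z ^+ N != 0 by rewrite expf_neq0.
have t1' : - t - 1 != 0 by rewrite -oppr_eq0 opprB opprK addrC.
by field; rewrite ?(E0, c0, kappa1, zn0, Q0, t1, t1').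
Qed.
End Positive.

End NumClosed.

(** * Translation of null sets and periodic properties *)

Section TranslationInvariance.
Local Open Scope classical_set_scope.
Variable R : realType.
Local Notation mu := (@lebesgue_measure R).

Let mtr (a : R) : measurable_fun setT
  ((fun x => x + a) : measurableTypeR R -> measurableTypeR R).
Proof. exact: measurable_realfun.measurable_funD. Qed.

(** Lebesgue measure is determined by its values on half-open intervals, whose length a shift
    preserves. *)
Lemma lebesgue_measure_translation (a : R) (A : set R) : measurable A ->
  pushforward mu ((fun x => x + a) : _ -> measurableTypeR R) A = mu A.
Proof.
move=> mA; apply/esym/lebesgue_measure_unique => //=.
move=> _ [[u v] _ <-].
rewrite /pushforward.
have -> : (fun x => x + a) @^-1` `]u, v] = `]u - a, v - a].
  by apply/seteqP; split => x /=; rewrite !in_itv /=; lra.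
rewrite !lebesgue_measure_itv/= !lte_fin ltrD2r.
by case: ifP => // _; rewrite -!EFinD; congr EFin; ring.
Qed.

Lemma negligible_translation (a : R) (A : set R) :
  mu.-negligible A -> mu.-negligible [set x | A (x + a)].
Proof.
move=> [B [mB B0 AB]]; exists ((fun x => x + a) @^-1` B); split.
- rewrite -[X in measurable X]setTI.
  exact: (mtr a measurableT B mB).
- exact: etrans (lebesgue_measure_translation a B mB) B0.
- by move=> x /AB.
Qed.

(** The exceptional set is covered by the translates of one null set by integer multiples of [p], a
    countable family. *)
Lemma ae_periodic (P : R -> Prop) (p a : R) : 0 < p ->
  (forall x, P (x + p) <-> P x) ->
  {ae mu, forall x, a <= x < a + p -> P x} -> {ae mu, forall x, P x}.
Proof.
move=> p0 per H.
have pern (n : nat) x : P (x + n%:R * p) <-> P x.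
  elim: n x => [|n IH] x; first by rewrite mul0r addr0.
  by rewrite -natr1 mulrDl mul1r addrA per IH.
have Hn (n : nat) : {ae mu, forall x, a <= x + n%:R * p < a + p -> P x}.
  have := negligible_translation (n%:R * p) _ H; apply: negligibleS => x /= nP Q.
  by apply: nP => Px; apply/(pern n); exact: Q.
have Hn' (n : nat) : {ae mu, forall x, a <= x - n%:R * p < a + p -> P x}.
  have := negligible_translation (- (n%:R * p)) _ H; apply: negligibleS => x /= nP Q.
  by apply: nP => /Q; rewrite -(pern n) subrK.
move: (ae_foralln Hn) (ae_foralln Hn'); apply: filterS2 => x h1 h2.
pose n := Num.floor ((x - a) / p).
have /andP[f1 f2] := floor_itv ((x - a) / p).
move: f1 f2; rewrite ler_pdivlMr // ltr_pdivrMr // -/n intrD mulrDl mul1r => f1 f2.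
(* [Negz n] is [-(n + 1)], hence the shift by [n.+1] in the second case. *)
case: n f1 f2 => n f1 f2; [apply: (h2 n)|apply: (h1 n.+1)].
  by move: f1 f2; rewrite -pmulrn; lra.
by move: f1 f2; rewrite NegzE mulrNz -pmulrn mulNr; lra.
Qed.
End TranslationInvariance.

Local Open Scope complex_scope.

(** * Chords of the unit circle and half-angle sines *)

Section Trig.
Variable R : realType.
Implicit Types x y : R.

Lemma expiD x y : expi (x + y) = expi x * expi y.
Proof. by rewrite /expi sinD cosD; apply/eqP; rewrite eq_complex /= eqxx /= addrC. Qed.

Lemma expi_unit x : expi x * (expi x)^* = 1.
Proof.
apply/eqP; rewrite eq_complex /= !mulrN opprK -!expr2 cos2Dsin2 eqxx /=.
by rewrite mulrC addrC subrr.
Qed.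

Lemma expi_neq0 x : expi x != 0.
Proof. by apply: contra_eq_neq (expi_unit x) => ->; rewrite mul0r eq_sym oner_eq0. Qed.

Lemma expiB x y :
  expi x - expi y = 2 * 'i * (sin ((x - y) / 2))%:C * expi ((x + y) / 2).
Proof.
set u := (x + y) / 2; set v := (x - y) / 2.
have -> : x = u + v by rewrite /u /v; field.
have -> : y = u - v by rewrite /u /v; field.
rewrite /expi sinD cosD sinB cosB.
apply/eqP; rewrite eq_complex /=; apply/andP; split; apply/eqP; ring.
Qed.

Lemma sg_sin_half x : - (2 * pi) < x < 2 * pi -> Num.sg (sin (x / 2)) = Num.sg x.
Proof.
move=> h; case: (sgrP x) => [->|x0|x0]; first by rewrite mul0r sin0 sgr0.
  by apply: gtr0_sg; apply: sin_gt0_pi; lra.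
apply: ltr0_sg; rewrite -oppr_gt0 -sinN -mulNr; apply: sin_gt0_pi; lra.
Qed.

Lemma expi_neq x y : sin ((x - y) / 2) != 0 -> expi x != expi y.
Proof.
move=> s0; rewrite -subr_eq0 expiB !mulf_neq0 ?expi_neq0 ?neq0Ci ?pnatr_eq0 //.
by rewrite fmorph_eq0.
Qed.

(** By [expiB] each chord carries the phase of a mean angle; the factor [expi ((a - b) / 2)] cancels
    the quotient of the two phases and leaves a real number. *)
Lemma expi_ratio (th a b : R) : sin ((th - a) / 2) != 0 ->
  expi ((a - b) / 2) * (expi th - expi b) / (expi th - expi a) =
  (sin ((th - b) / 2) / sin ((th - a) / 2))%:C.
Proof.
move=> s0; rewrite !expiB rmorphM fmorphV /=.
have -> : (th + a) / 2 = (a - b) / 2 + (th + b) / 2 by field.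
rewrite expiD.
have i0 : 'i != 0 :> R[i] by exact: neq0Ci.
have s0' : (sin ((th - a) / 2))%:C != 0 :> R[i] by rewrite fmorph_eq0.
by field; rewrite i0 s0' !expi_neq0.
Qed.

Lemma Arg_imag x : Arg ('i * x%:C) = Num.sg x * (pi / 2).
Proof.
rewrite /Arg /=.
rewrite !(mul0r, mul1r, mulr0) subr0 add0r ltxx.
by case: sgrP => _; rewrite ?(mul0r,mul1r,mulN1r).
Qed.

End Trig.

(** * Signs on the arcs and weights at the poles *)

Section Arcs.
Context (R : realType) (t : nat -> R).

Lemma increasing_upto n : (forall j, (j < n)%N -> t j < t j.+1) ->
  forall i j, (i < j)%N -> (j <= n)%N -> t i < t j.
Proof.
move=> tS i; elim=> // j IH; rewrite ltnS leq_eqVlt => /predU1P[->|ij] jn.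
  exact: tS.
exact: lt_trans (IH ij (ltnW jn)) (tS _ jn).
Qed.

Lemma arc_containing n x : t 0%N <= x < t n ->
  exists2 j, (j < n)%N & t j <= x < t j.+1.
Proof.
elim: n => [|n IH] /andP[h0 hn]; first by have := le_lt_trans h0 hn; rewrite ltxx.
have [xn|nx] := ltP x (t n); last by exists n => //; rewrite nx.
by have [|j jn hj] := IH; [rewrite h0|exists j => //; exact: leqW].
Qed.

Context (N : nat).
Hypotheses (tS : forall j, (j < 2 * N)%N -> t j < t j.+1)
  (t_end : t (2 * N)%N = t 0%N + 2 * pi).

Let half_sin i j := sin ((t i - t j) / 2).

(** Both [x] and [t l] lie in one turn starting at [t 0], so they differ by less than [2 * pi] and
    the half-angle sine has the sign of [x - t l]. *)
Lemma sg_sin_arc j l x : (j < 2 * N)%N -> (l < 2 * N)%N -> t j < x < t j.+1 ->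
  Num.sg (sin ((x - t l) / 2)) = if (l <= j)%N then 1 else -1.
Proof.
move=> jN lN /andP[jx xj].
have inc := increasing_upto _ tS.
have inc' a b : (a <= b)%N -> (b <= 2 * N)%N -> t a <= t b.
  by rewrite leq_eqVlt => /predU1P[->//|ab bN]; apply: ltW; exact: inc.
have h0 := inc' 0%N j isT (ltnW jN); have h1 := inc' _ _ jN (leqnn _).
have h2 := inc' 0%N l isT (ltnW lN); have h3 := inc _ _ lN (leqnn _).
rewrite sg_sin_half; last by move: t_end; lra.
case: leqP => lj; [apply: gtr0_sg|apply: ltr0_sg].
  by have := inc' _ _ lj (ltnW jN); lra.
by have := inc' _ _ lj (ltnW lN); lra.
Qed.

Lemma sg_sin_pts i j : (i < 2 * N)%N -> (j < 2 * N)%N ->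
  Num.sg (half_sin i j) = if (i == j)%N then 0 else if (j < i)%N then 1 else -1.
Proof.
move=> iN jN; have inc := increasing_upto _ tS.
have h1 : t 0%N <= t i.
  by case: i iN => // i /ltnW iN; apply/ltW/inc.
have h2 : t 0%N <= t j.
  by case: j jN => // j /ltnW jN; apply/ltW/inc.
have := inc _ _ iN (leqnn _); have := inc _ _ jN (leqnn _) => h3 h4.
rewrite /half_sin sg_sin_half; last by move: t_end; lra.
case: (ltngtP i j) => ij; last by rewrite ij subrr sgr0.
  by apply: ltr0_sg; rewrite subr_lt0; apply: inc => //; exact: ltnW.
by apply: gtr0_sg; rewrite subr_gt0; apply: inc => //; exact: ltnW.
Qed.

Let even_lt (k : 'I_N) : (2 * k < 2 * N)%N. Proof. by have := ltn_ord k; lia. Qed.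
Let odd_lt (k : 'I_N) : ((2 * k).+1 < 2 * N)%N. Proof. by have := ltn_ord k; lia. Qed.

Let ratio x (k : 'I_N) := sin ((x - t (2 * k).+1) / 2) / sin ((x - t (2 * k)%N) / 2).

(** The factor [k] is negative exactly when [x] lies between [t (2 * k)] and its successor, that is
    for [j = 2 * k]. So one factor is negative for even [j], with [k = j./2], and none for odd
    [j]. *)
Lemma sg_prod_ratio j x : (j < 2 * N)%N -> t j < x < t j.+1 ->
  Num.sg (- \prod_(k < N) ratio x k) = (-1) ^+ j.
Proof.
move=> jN jx; rewrite sgrN (big_morph _ (@sgrM R) (@sgr1 R)).
have E k : Num.sg (ratio x k) = if j == (2 * k)%N then -1 else 1.
  rewrite /ratio sgrM sgrV !(sg_sin_arc j) //.
  by case: eqP => [->|jk]; do 2 case: ifP; rewrite ?mulr1 ?mulrNN ?mulr1 //; lia.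
rewrite (eq_bigr _ (fun k _ => E k)).
rewrite -signr_odd; case: (boolP (odd j)) => oj.
  by rewrite big1 ?expr1 // => k _; case: eqP => // jk; move: oj; rewrite jk; lia.
have jN' : (j./2 < N)%N by lia.
rewrite (bigD1 (Ordinal jN')) //= ifT ?big1 ?mulr1 ?opprK //; last by lia.
by move=> k; rewrite -val_eqE /= => kj; case: eqP => // jk; lia.
Qed.

Let e (k : 'I_N) : R[i] := expi (t (2 * k)%N).
Let f (k : 'I_N) : R[i] := expi (t (2 * k).+1).
(** By [expi_ratio] these phases make each factor of [T] real on the circle; the [- 'i] in [kappa]
    then makes [T] imaginary there. *)
Let w (k : 'I_N) : R[i] := expi ((t (2 * k)%N - t (2 * k).+1) / 2).
Let kappa : R[i] := - 'i * \prod_(k < N) w k.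
Let m (k : 'I_N) : R :=
  - half_sin (2 * k)%N (2 * k).+1 * \prod_(l < N | l != k) ratio (t (2 * k)%N) l.

(** The point [e k] precedes [f k], so the first sine is negative; for [l != k] the consecutive
    points [e l] and [f l] lie on the same side of [e k], so their two sines have equal signs. *)
Lemma node_weight_gt0 k : 0 < m k.
Proof.
rewrite /m mulr_gt0 //.
  by rewrite oppr_gt0 -sgr_lt0 sg_sin_pts // ifN ?ifN //; lia.
apply: prodr_gt0 => l lk; rewrite -sgr_gt0 /ratio sgrM sgrV.
have lk' : l != k :> nat by [].
rewrite !sg_sin_pts //; do !case: ifP; rewrite ?mulr1 ?mulrNN ?mulr1 //; lia.
Qed.

Lemma half_sin_neq0 i j : (i < 2 * N)%N -> (j < 2 * N)%N -> i != j -> half_sin i j != 0.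
Proof. by move=> iN jN ij; rewrite -sgr_eq0 sg_sin_pts // (negPf ij); case: ifP. Qed.

Lemma even_node_inj : injective e.
Proof.
move=> k l; apply: contra_eq => kl; apply/expi_neq/half_sin_neq0 => //.
by have : k != l :> nat by []; lia.
Qed.

Lemma odd_even_node_neq k l : f l != e k.
Proof. by apply/expi_neq/half_sin_neq0 => //; lia. Qed.

Lemma node_residue k :
  kappa * \prod_(l < N) (e k - f l) / \prod_(l < N | l != k) (e k - e l) =
  - 2 * (m k)%:C * e k.
Proof.
have -> : (m k)%:C = - (half_sin (2 * k)%N (2 * k).+1)%:C *
    \prod_(l < N | l != k) (w l * (e k - f l) / (e k - e l)).
  rewrite /m rmorphM rmorphN rmorph_prod; congr (_ * _); apply: eq_bigr => l lk.
  rewrite /w /e /f expi_ratio //; apply: half_sin_neq0 => //.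
  by have : l != k :> nat by []; lia.
rewrite prodf_div big_split /= /kappa !(bigD1 k (P := predT)) //=.
have -> : e k - f k = 2 * 'i * (half_sin (2 * k)%N (2 * k).+1)%:C *
    expi ((t (2 * k)%N + t (2 * k).+1) / 2) by rewrite expiB.
(* Turning the mean-angle phase of the chord by [w k] gives [e k], the last factor of the
   residue. *)
have -> : e k = w k * expi ((t (2 * k)%N + t (2 * k).+1) / 2).
  by rewrite -expiD; congr expi; field.
set P := \prod_(_ < N | _) _; set Q := \prod_(_ < N | _) _; set S := \prod_(_ < N | _) _.
set s := _%:C; set u := expi _; set v := w k.
have -> : - 'i * (v * P) * (2 * 'i * s * u * Q) / S =
  - ('i ^+ 2) * (v * P) * (2 * s * u * Q) / S by ring.
by rewrite sqrCi; ring.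
Qed.

End Arcs.

(** * The step function as an argument almost everywhere *)

Theorem theorem5p1 (R : realType) (c : R) (N : nat) (psi : R[i] -> R) :
  0 < c -> (0 < N)%N -> alternating_step c N psi ->
  exists omega : R[i] -> R[i],
    finite_blaschke_of_order N omega /\
    {ae (@lebesgue_measure R), forall th : R,
       psi (expi th) =
         (2 * c / pi) * Arg ((1 + omega (expi th)) / (1 - omega (expi th)))}.
Proof.
move=> c0 N0 [t [tS [t_end psi_arc]]].
pose kappa : R[i] := - 'i * \prod_(k < N) expi ((t (2 * k)%N - t (2 * k).+1) / 2).
have kappa0 : kappa != 0.
  rewrite mulf_neq0 ?oppr_eq0 ?neq0Ci //.
  by apply/prodf_neq0 => k _; exact: expi_neq0.
have [|lam [a [lam1 [a1 blE]]]] := blaschke_of_quotient R[i] N _ _ _ kappa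
  (even_node_inj _ _ _ tS t_end) (fun k => expi_unit _ _) _
  (node_residue _ _ _ tS t_end) (Ordinal N0) (expi_unit _ _)
  (odd_even_node_neq _ _ _ tS t_end) kappa0.
  by move=> k; rewrite lecR ltW // node_weight_gt0.
exists (blaschke lam a); split; first by exists lam, a.
apply: (@ae_periodic _ _ (2 * pi) (t 0%N)).
- by rewrite mulr_gt0 ?pi_gt0.
- by move=> x; rewrite (_ : expi (x + 2 * pi) = expi x) // /expi mulr_natl sinD2pi cosD2pi.
(* Discarding the countably many points [t j] turns the half-open arcs of [arc_containing] into open
   ones, where no sine in a denominator vanishes. *)
have generic (j : nat) : {ae (@lebesgue_measure R), forall th, th <> t j}.
  exists [set t j]%classic; split => //; first exact: lebesgue_measure_set1.
  by move=> x /= /contrapT.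
have psi_arc' (j : nat) : {ae (@lebesgue_measure R), forall th : R,
    (j < 2 * N)%N -> t j < th < t j.+1 -> psi (expi th) = (-1) ^+ j * c}.
  have [jN|jN] := boolP (j < 2 * N)%N; last exact: aeW.
  have := psi_arc j jN; apply: negligibleS => x /= nQ Q; apply: nQ => _ xj.
  by apply: Q; apply/mem_set; rewrite /= in_itv.
move: (ae_foralln generic) (ae_foralln psi_arc'); apply: filterS2 => x xt px.
rewrite -t_end => xarc.
have [j jN /andP[jx xj]] := arc_containing _ _ _ _ xarc.
have xj' : t j < x < t j.+1.
  by rewrite xj andbT lt_neqAle jx andbT; apply/eqP => /esym; exact: xt.
rewrite (px j jN xj').
pose y := - \prod_(k < N)
  (sin ((x - t (2 * k).+1) / 2) / sin ((x - t (2 * k)%N) / 2)).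
have sgy : Num.sg y = (-1) ^+ j by exact: sg_prod_ratio.
have s0 (k : 'I_N) : sin ((x - t (2 * k)%N) / 2) != 0.
  rewrite -sgr_eq0 (sg_sin_arc _ _ N tS t_end j) //.
    by case: ifP; rewrite ?oppr_eq0 oner_eq0.
  by have := ltn_ord k; lia.
have blxE := blE (expi x) (expi_unit _ _) (fun k => expi_neq _ _ _ (s0 k)).
have TE : kappa * \prod_(k < N) ((expi x - expi (t (2 * k).+1)) /
    (expi x - expi (t (2 * k)%N))) = 'i * y%:C.
  rewrite /kappa -mulrA -big_split /= /y rmorphN rmorph_prod /= mulrN mulNr.
  congr (- (_ * _)); apply: eq_bigr => k _.
  by rewrite mulrA; exact: expi_ratio.
have T1 : 'i * y%:C + 1 != 0 :> R[i].
  rewrite eq_complex /=; apply/negP => /andP[/eqP + _]; lra.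
(* On the circle the Blaschke product is [(T - 1) / (T + 1)], and the inverse Cayley transform
   returns [T]. *)
have -> : (1 + blaschke lam a (expi x)) / (1 - blaschke lam a (expi x)) =
    'i * y%:C.
  by rewrite /blaschke blxE TE; exact: (cayleyK R[i]).
rewrite Arg_imag sgy; move: (@pi R) (pi_gt0 R) => p p0.
by field; exact: lt0r_neq0.
Qed.
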